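(* Let $\mathcal C\subset\mathbb R^n$ be nonempty, compact and convex; let $f:\mathbb R^n\to\mathbb R$ be continuously differentiable on an open set containing $\mathcal C$ with $\nabla f$ Lipschitz-continuous on $\mathcal C$ with constant $L_{\nabla f}>0$; let $T:\mathbb R^n\to\mathbb R^m$ be linear; and let $g:\mathbb R^m\to\,]-\infty,+\infty]$ satisfy either (I) $g=\iota_{\mathcal D}$ for a nonempty closed convex set $\mathcal D\subset\mathbb R^m$ (put $\rho=0$), or (II) $g$ is real-valued, $L_g$-Lipschitz on $\mathbb R^m$ and $\rho$-weakly convex for some $\rho\ge 0$. Fix $p,q\in\,]0,1[$ with $q<p$ and $p+q<1$, and set $\gamma_k=(k+1)^{-p}$, $\beta_k=\beta_0(k+1)^{-q}$ with $\beta_0\in\,]0,\rho^{-1}[$. Let $(x_k)_{k\in\mathbb N}$ be generated by FRAMES with these schedules. Define $$C_{p,q}:=L_f D_{\mathcal C}+2^qB\beta_0^{-1}+\frac{D_{\mathcal C}^2}{2}\left(\frac{L_{\nabla f}}{1-p}+\frac{\|T\|_{\mathrm{op}}^2M_{\rho,\beta_0}\beta_0^{-1}}{1-p+q}\right).$$ Then for every integer $N\ge1$, $$0\le\frac1N\sum_{k=0}^{N-1}\mathrm{gap}^{\beta_k}(x_k)\le C_{p,q}N^{-\min\{p-q,\,1-p-q\}},$$ and consequently $$0\le\min_{0\le k\le N-1}\mathrm{gap}^{\beta_k}(x_k)\le C_{p,q}N^{-\min\{p-q,\,1-p-q\}}.$$ In particular, for $p=1/2$ and $q=1/4$, with $$C:=L_fD_{\mathcal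 C}+2^{1/4}B\beta_0^{-1}+L_{\nabla f}D_{\mathcal C}^2+\tfrac{2D_{\mathcal C}^2}{3}\|T\|_{\mathrm{op}}^2M_{\rho,\beta_0}\beta_0^{-1},$$ one has for every $N\ge 1$ that $0\le\frac1N\sum_{k=0}^{N-1}\mathrm{gap}^{\beta_k}(x_k)\le CN^{-1/4}$ and $0\le\min_{0\le k\le N-1}\mathrm{gap}^{\beta_k}(x_k)\le CN^{-1/4}$.
   Context: Conventions: $\rho^{-1}=+\infty$ if $\rho=0$. $\rho$-weakly convex means $g+\frac{\rho}{2}\|\cdot\|_2^2$ is convex. $\iota_{\mathcal D}$ is $0$ on $\mathcal D$ and $+\infty$ elsewhere; $\mathrm{dist}_{\mathcal D}(y)=\inf_{u\in\mathcal D}\|y-u\|_2$. For $\beta\in\,]0,\rho^{-1}[$: $\mathrm{prox}_{\beta g}(y)=\operatorname{argmin}_u\{g(u)+\frac1{2\beta}\|u-y\|_2^2\}$ (unique), and the Moreau envelope is $g^\beta(y)=\min_u\{g(u)+\frac1{2\beta}\|u-y\|_2^2\}$, which is continuously differentiable with $\nabla g^\beta(y)=\beta^{-1}(y-\mathrm{prox}_{\beta g}(y))$. Smoothed Frank-Wolfe gap: for $x\in\mathcal C$, $\mathrm{gap}^\beta(x):=\max_{s\in\mathcal C}\langle\nabla f(x)+T^*\nabla g^\beta(Tx),x-s\rangle$. FRAMES: given $x_0\in\mathcal C$, step sizes $\gamma_k\in\,]0,1]$ and smoothing parameters $\beta_k\in\,]0,\rho^{-1}[$, for $k=0,1,2,\dots$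 let $\Phi_k(x)=f(x)+g^{\beta_k}(Tx)$, choose any $s_k\in\operatorname{argmin}_{s\in\mathcal C}\langle\nabla\Phi_k(x_k),s\rangle$, and set $x_{k+1}=x_k+\gamma_k(s_k-x_k)$. Constants: $D_{\mathcal C}=\sup_{x,y\in\mathcal C}\|x-y\|_2$; $D_{T(\mathcal C)}=\sup_{x,y\in\mathcal C}\|Tx-Ty\|_2$; $L_f=\sup_{x\in\mathcal C}\|\nabla f(x)\|_2$; $B_{\mathrm{prox}}=\max_{z\in T(\mathcal C)}\mathrm{dist}_{\mathcal D}(z)$ in case (I) and $B_{\mathrm{prox}}=\beta_0L_g$ in case (II); $B=\max\{\frac12B_{\mathrm{prox}}^2,\ B_{\mathrm{prox}}D_{T(\mathcal C)}\}$; $M_{\rho,\beta_0}=\max\{1,\frac{\rho\beta_0}{1-\rho\beta_0}\}$. *)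

(* Defs.v *)
From HB Require Import structures.
From mathcomp Require Import all_boot all_order all_algebra.
From mathcomp Require Import all_classical all_reals all_analysis.
Set Implicit Arguments.
Unset Strict Implicit.
Unset Printing Implicit Defensive.
Import Order.TTheory GRing.Theory Num.Theory.
Import numFieldNormedType.Exports.
Local Open Scope classical_set_scope.
Local Open Scope ring_scope.

(* The library norm on ['rV[R]_n] is the sup norm.  It is used below only
   through the topology (compact, closed, open, differentiable), which is the
   Euclidean one; every metric quantity uses [enorm]. *)
Section Euclidean.
Context {R : realType}.

Definition dotv n (u v : 'rV[R]_n) : R := \sum_i u 0 i * v 0 i.

Definition enorm n (u : 'rV[R]_n) : R := Num.sqrt (dotv u u).

Definition ediam n (A : set 'rV[R]_n) : R :=
  sup [set enorm (x - y) | x in A & y in A].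

Definition edist n (A : set 'rV[R]_n) (y : 'rV[R]_n) : R :=
  inf [set enorm (y - u) | u in A].

Definition elipschitz_on n m (A : set 'rV[R]_n) (L : R)
    (F : 'rV[R]_n -> 'rV[R]_m) : Prop :=
  forall x y, A x -> A y -> enorm (F x - F y) <= L * enorm (x - y).

Definition opnorm n m (T : {linear 'rV[R]_n -> 'rV[R]_m}) : R :=
  sup [set enorm (T x) | x in [set x | enorm x <= 1]].

Definition adjoint n m (T : {linear 'rV[R]_n -> 'rV[R]_m}) (v : 'rV[R]_m) :
  'rV[R]_n := v *m (lin1_mx T)^T.

Definition gradient n (f : 'rV[R]_n -> R) (x : 'rV[R]_n) : 'rV[R]_n :=
  \row_i 'd f x (delta_mx 0 i).

Lemma dotvE n (u v : 'rV[R]_n) : dotv u v = (u *m v^T) 0 0.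
Proof. by rewrite mxE; apply: eq_bigr => i _; rewrite mxE. Qed.

Lemma dotv_adjoint n m (T : {linear 'rV[R]_n -> 'rV[R]_m}) x v :
  dotv (T x) v = dotv x (adjoint T v).
Proof.
by rewrite !dotvE /adjoint trmx_mul trmxK mulmxA mul_rV_lin1.
Qed.

Lemma dotv_gradient n (f : 'rV[R]_n -> R) x v :
  dotv (gradient f x) v = 'd f x v.
Proof.
rewrite [in RHS](row_sum_delta v) linear_sum; apply: eq_bigr => i _.
by rewrite linearZ mxE mulrC.
Qed.

Definition C1_near n (C : set 'rV[R]_n) (f : 'rV[R]_n -> R) : Prop :=
  exists U : set 'rV[R]_n, [/\ open U, C `<=` U &
    forall x, U x -> differentiable f x /\ {for x, continuous (gradient f)}].

End Euclidean.

Section Penalty.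
Context {R : realType}.

Definition einfty_indic m (D : set 'rV[R]_m) (y : 'rV[R]_m) : \bar R :=
  if y \in D then 0%E else +oo%E.

Definition weakly_convex m (rho : R) (h : 'rV[R]_m -> R) : Prop :=
  @convex_function R (convex_lmodType 'rV[R]_m) setT
    (fun y => h y + rho / 2 * enorm y ^+ 2).

Definition moreau_fun m (g : 'rV[R]_m -> \bar R) (beta : R)
    (y u : 'rV[R]_m) : \bar R :=
  (g u + ((2 * beta)^-1 * enorm (u - y) ^+ 2)%:E)%E.

(* The minimum defining the envelope is written as an infimum in [\bar R]; it is
   finite for [0 < beta] with [rho * beta < 1], so that [fine] loses nothing. *)
Definition moreau m (g : 'rV[R]_m -> \bar R) (beta : R) (y : 'rV[R]_m) : R :=
  fine (ereal_inf (range (moreau_fun g beta y))).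

(* [Bprox] depends on which case holds, and so is tied to it here. *)
Definition penalty_caseI m (TC : set 'rV[R]_m) (g : 'rV[R]_m -> \bar R)
    (rho Bprox : R) : Prop :=
  exists D : set 'rV[R]_m,
    [/\ D !=set0, closed D, @convex_set R 'rV[R]_m D, g = einfty_indic D &
        rho = 0 /\ Bprox = sup [set edist D z | z in TC]].

Definition penalty_caseII m (beta0 : R) (g : 'rV[R]_m -> \bar R)
    (rho Bprox : R) : Prop :=
  exists (h : 'rV[R]_m -> R) (Lg : R),
    [/\ g = EFin \o h, 0 <= Lg,
        (forall y z, `|h y - h z| <= Lg * enorm (y - z)),
        0 <= rho /\ weakly_convex rho h & Bprox = beta0 * Lg].

End Penalty.

Section Frames.
Context {R : realType} (n m : nat).
Variables (C : set 'rV[R]_n) (f : 'rV[R]_n -> R).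
Variables (T : {linear 'rV[R]_n -> 'rV[R]_m}) (g : 'rV[R]_m -> \bar R).

(* A maximum: [C] is nonempty and compact. *)
Definition gap (beta : R) (x : 'rV[R]_n) : R :=
  sup [set dotv (gradient f x + adjoint T (gradient (moreau g beta) (T x)))
            (x - s) | s in C].

Definition smoothed_obj (beta : R) (x : 'rV[R]_n) : R :=
  f x + moreau g beta (T x).

Definition linear_argmin (v : 'rV[R]_n) : set 'rV[R]_n :=
  [set s | C s /\ forall s', C s' -> dotv v s <= dotv v s'].

Definition frames (gamma beta : nat -> R) (x s : nat -> 'rV[R]_n) : Prop :=
  C (x 0%N) /\ forall k,
    linear_argmin (gradient (smoothed_obj (beta k)) (x k)) (s k) /\
    x k.+1 = x k + gamma k *: (s k - x k).

Definition lip_f : R := sup [set enorm (gradient f x) | x in C].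

Definition constB (Bprox : R) : R :=
  Num.max (Bprox ^+ 2 / 2) (Bprox * ediam (T @` C)).

Definition constM (rho beta0 : R) : R :=
  Num.max 1 (rho * beta0 / (1 - rho * beta0)).

Definition constC (L rho Bprox beta0 p q : R) : R :=
  lip_f * ediam C + 2 `^ q * constB Bprox / beta0 +
  ediam C ^+ 2 / 2 * (L / (1 - p) +
    opnorm T ^+ 2 * constM rho beta0 / beta0 / (1 - p + q)).

Definition constC_quarter (L rho Bprox beta0 : R) : R :=
  lip_f * ediam C + 2 `^ (4^-1) * constB Bprox / beta0 +
  L * ediam C ^+ 2 +
  2 * ediam C ^+ 2 / 3 * opnorm T ^+ 2 * constM rho beta0 / beta0.

End Frames.

Definition power_step {R : realType} (p : R) (k : nat) : R :=
  k.+1%:R `^ (- p).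

Definition power_smoothing {R : realType} (beta0 q : R) (k : nat) : R :=
  beta0 * k.+1%:R `^ (- q).

Definition avg_upto {R : realType} (a : nat -> R) (N : nat) : R :=
  N%:R^-1 * \sum_(0 <= k < N) a k.

(* The unit [a 0] of the iterated minimum is neutral when [0 < N]. *)
Definition min_upto {R : realType} (a : nat -> R) (N : nat) : R :=
  \big[Num.min/a 0%N]_(0 <= k < N) a k.

(* Main.v *)
(* Each proximal point u of y satisfies a quadratic growth inequality, because the
   prox objective is (1/beta - rho)-strongly convex.  Testing the envelope at u
   from above, and using the growth inequality from below, sandwiches it between
   two quadratics with common slope (y - u) / beta at y: hence the envelope is
   differentiable, and the upper quadratic is the descent inequality with
   constant 1 / beta (so M >= 1 is all that is needed of M).  Together with the
   descent inequality for f, one step gives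
     gap_k <= gamma_k^-1 (Phi_k(x_k) - Phi_k(x_(k+1)))
              + gamma_k D_C^2 (L + ||T||^2 / beta_k) / 2.
   The first terms are summed by parts, separately for f, which oscillates by at
   most L_f D_C on C, and for the envelopes, which on T(C) lie below c + B / beta_k
   for one constant c.  Power sums and a division by N give the rate. *)
Require Import Defs.
From HB Require Import structures.
From mathcomp Require Import all_boot all_order all_algebra.
From mathcomp Require Import all_classical all_reals all_analysis.
From mathcomp Require Import ring lra zify.
Import Order.TTheory GRing.Theory Num.Theory.
Import numFieldNormedType.Exports.
Local Open Scope classical_set_scope.
Local Open Scope ring_scope.
Set Implicit Arguments.
Unset Strict Implicit.
Unset Printing Implicit Defensive.

(** * Euclidean geometry of row vectors *)

Section EuclideanGeometry.
Context {R : realType}.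

Section vectors.
Context {n : nat}.
Implicit Types u v w : 'rV[R]_n.

Lemma dotvC u v : dotv u v = dotv v u.
Proof. by apply: eq_bigr => i _; rewrite mulrC. Qed.

Lemma dotvDl u v w : dotv (u + v) w = dotv u w + dotv v w.
Proof. by rewrite -big_split; apply: eq_bigr => i _; rewrite mxE mulrDl. Qed.

Lemma dotvDr u v w : dotv w (u + v) = dotv w u + dotv w v.
Proof. by rewrite !(dotvC w) dotvDl. Qed.

Lemma dotvZl (a : R) u v : dotv (a *: u) v = a * dotv u v.
Proof. by rewrite mulr_sumr; apply: eq_bigr => i _; rewrite mxE mulrA. Qed.

Lemma dotvZr (a : R) u v : dotv v (a *: u) = a * dotv v u.
Proof. by rewrite !(dotvC v) dotvZl. Qed.

Lemma dotvNl u v : dotv (- u) v = - dotv u v.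
Proof. by rewrite -scaleN1r dotvZl mulN1r. Qed.

Lemma dotvNr u v : dotv v (- u) = - dotv v u.
Proof. by rewrite !(dotvC v) dotvNl. Qed.

Definition dotv_linE :=
  (dotvDl, dotvDr, dotvNl, dotvNr, dotvZl, dotvZr).

Lemma dotvv_ge0 u : 0 <= dotv u u.
Proof. by apply: sumr_ge0 => i _; rewrite -expr2 sqr_ge0. Qed.

Lemma enorm_ge0 u : 0 <= enorm u.
Proof. exact: sqrtr_ge0. Qed.

Lemma enorm_sqr u : enorm u ^+ 2 = dotv u u.
Proof. by rewrite sqr_sqrtr ?dotvv_ge0. Qed.

Lemma enormN u : enorm (- u) = enorm u.
Proof. by rewrite /enorm dotvNl dotvNr opprK. Qed.

Lemma enormB u v : enorm (u - v) = enorm (v - u).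
Proof. by rewrite -enormN opprB. Qed.

Lemma enormZ (a : R) u : enorm (a *: u) = `|a| * enorm u.
Proof.
by rewrite /enorm dotvZl dotvZr mulrA -expr2 sqrtrM ?sqr_ge0// sqrtr_sqr.
Qed.

Lemma enorm0 : enorm (0 : 'rV[R]_n) = 0.
Proof. by rewrite -(scale0r 0) enormZ normr0 mul0r. Qed.

Lemma dotv_eq0r u v : dotv v v = 0 -> dotv u v = 0.
Proof.
move=> /eqP; rewrite psumr_eq0 => [/allP v0|i _]; last by rewrite -expr2 sqr_ge0.
rewrite /dotv big1// => i _; have := v0 i (mem_index_enum i).
by rewrite mulf_eq0 orbb => /eqP ->; rewrite mulr0.
Qed.

(** Cauchy-Schwarz: expanding the squared norm of [dotv v v *: u - dotv u v *: v] gives [dotv v v]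
    times the difference of the two sides. *)
Lemma dotv_sqr_le u v : dotv u v ^+ 2 <= dotv u u * dotv v v.
Proof.
have [v0|vn0] := eqVneq (dotv v v) 0.
  by rewrite (dotv_eq0r u v0) v0 expr0n mulr0.
have vgt0 : 0 < dotv v v by rewrite lt_neqAle eq_sym vn0 dotvv_ge0.
have := dotvv_ge0 (dotv v v *: u - dotv u v *: v).
rewrite !dotv_linE (dotvC v u) => H.
rewrite -subr_ge0 -(pmulr_rge0 _ vgt0); apply: le_trans H _.
by rewrite le_eqVlt; apply/orP; left; apply/eqP; ring.
Qed.

Lemma dotv_le u v : dotv u v <= enorm u * enorm v.
Proof.
rewrite (le_trans (ler_norm _))// -(@ler_pXn2r _ 2)// ?nnegrE ?mulr_ge0 ?enorm_ge0//.
by rewrite real_normK ?num_real// exprMn !enorm_sqr dotv_sqr_le.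
Qed.

Lemma enorm_sqrD u v :
  enorm (u + v) ^+ 2 = enorm u ^+ 2 + 2 * dotv u v + enorm v ^+ 2.
Proof. by rewrite !enorm_sqr !dotv_linE (dotvC v u); ring. Qed.

Lemma enormD u v : enorm (u + v) <= enorm u + enorm v.
Proof.
rewrite -(@ler_pXn2r _ 2)// ?nnegrE ?addr_ge0 ?enorm_ge0//.
by rewrite enorm_sqrD; have := dotv_le u v; nra.
Qed.

Lemma ler_enorm_sub u v : `|enorm u - enorm v| <= enorm (u - v).
Proof.
have := enormD (u - v) v; have := enormD (v - u) u.
by rewrite !subrK (enormB v u) ler_norml => ? ?; apply/andP; split; lra.
Qed.

Lemma ler_coord_enorm u i : `|u 0 i| <= enorm u.
Proof.
rewrite -sqrtr_sqr ler_wsqrtr// /dotv (bigD1 i)//= -expr2 lerDl.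
by apply: sumr_ge0 => j _; rewrite -expr2 sqr_ge0.
Qed.

Lemma ler_coord_norm u i : `|u 0 i| <= `|u|.
Proof.
rewrite [leRHS]/Num.norm/= mx_normrE; apply/bigmax_geP; right => /=.
by exists (ord0, i).
Qed.

Lemma enorm_sqr_le_norm u : enorm u ^+ 2 <= n%:R * `|u| ^+ 2.
Proof.
rewrite enorm_sqr mulr_natl -[X in _ *+ X]card_ord -sumr_const.
apply: ler_sum => i _; rewrite -expr2 -real_normK ?num_real//.
by rewrite ler_pXn2r ?nnegrE// ler_coord_norm.
Qed.

Lemma norm_le_enorm u : `|u| <= enorm u.
Proof.
rewrite [leLHS]/Num.norm/= mx_normrE; apply/bigmax_leP; split => [|[i j] _] /=.
  exact: enorm_ge0.
by rewrite ord1 ler_coord_enorm.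
Qed.

(** The factor is cruder than the square root of [n], but it stays positive at [n = 0] and can be
    divided by. *)
Lemma enorm_le_norm u : enorm u <= n.+1%:R * `|u|.
Proof.
rewrite -(@ler_pXn2r _ 2)// ?nnegrE ?mulr_ge0 ?enorm_ge0//.
rewrite exprMn (le_trans (enorm_sqr_le_norm u))// ler_wpM2r ?sqr_ge0//.
by rewrite -natrX ler_nat expnS expn1; lia.
Qed.

Lemma enorm_lipschitz_continuous (V : normedModType R) (K : R)
    (F : 'rV[R]_n -> V) :
  (forall u v, `|F u - F v| <= K * enorm (u - v)) -> continuous F.
Proof.
move=> FK u; apply/(@cvgrPdist_le _ _ _ (nbhs u) (nbhs_filter u)) => e e0.
(* Adding 1 to the absolute value keeps the factor positive whatever the sign of [K]. *)
have K0 : 0 < (`|K| + 1) * n.+1%:R by rewrite mulr_gt0// ltr_wpDl.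
apply/nbhs_ballP; exists (e / ((`|K| + 1) * n.+1%:R)); first exact: divr_gt0.
move=> v; rewrite -ball_normE => /ltW uv.
apply: le_trans (FK u v) _.
apply: (@le_trans _ _ ((`|K| + 1) * n.+1%:R * `|u - v|)).
  rewrite -mulrA (@le_trans _ _ ((`|K| + 1) * enorm (u - v)))//.
    by rewrite ler_wpM2r ?enorm_ge0// (le_trans (ler_norm K))// lerDl.
  by rewrite ler_wpM2l ?enorm_le_norm// addr_ge0.
by rewrite -ler_pdivlMl// mulrC.
Qed.

End vectors.
End EuclideanGeometry.

(** * Differentiability from quadratic bounds *)

Section Gradient.
Context {R : realType} {n : nat}.
Implicit Types (F : 'rV[R]_n -> R) (u v y z : 'rV[R]_n).

(** A quadratic remainder is little-o of the displacement, so [dotv v] is a differential of [F] at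
    [y]; uniqueness of the differential identifies the gradient. *)
Lemma gradient_of_quadratic_bound F y v (K : R) :
  (forall z, `|F z - F y - dotv v (z - y)| <= K * enorm (z - y) ^+ 2) ->
  differentiable F y /\ gradient F y = v.
Proof.
move=> FK.
have dlin : linear (dotv v : 'rV[R]_n -> R).
  by move=> a u w; rewrite dotvDr dotvZr.
pose dv : {linear 'rV[R]_n -> R} :=
  HB.pack (dotv v) (GRing.isLinear.Build _ _ _ _ _ dlin).
have dvc : continuous dv.
  apply: (@enorm_lipschitz_continuous _ _ _ (enorm v)) => a b.
  rewrite -[dv a - dv b]/(dotv v a - dotv v b) -dotvNr -dotvDr ler_norml.
  rewrite lerNl -dotvNl; apply/andP; split; last exact: dotv_le.
  by rewrite -(enormN v) dotv_le.
have Flin : F \o shift y = cst (F y) + dv +o_ (0 : 'rV[R]_n) id.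
  apply/eqaddoP => e e0.
  have K0 : 0 < (`|K| + 1) * n.+1%:R by rewrite mulr_gt0// ltr_wpDl.
  apply/nbhs_ballP; exists (e / ((`|K| + 1) * n.+1%:R)); first exact: divr_gt0.
  move=> u; rewrite -ball_normE /= sub0r normrN => /ltW ue.
  rewrite -[X in `|X|]/(F (u + y) - (F y + dotv v u)).
  have := FK (u + y); rewrite addrK opprD addrA => /le_trans; apply.
  apply: (@le_trans _ _ ((`|K| + 1) * (n.+1%:R * `|u| ^+ 2))).
    apply: (@le_trans _ _ ((`|K| + 1) * enorm u ^+ 2)).
      by rewrite ler_wpM2r ?sqr_ge0// (le_trans (ler_norm K))// lerDl.
    rewrite ler_wpM2l// ?addr_ge0//.
    apply: le_trans (enorm_sqr_le_norm u) _.
    by rewrite ler_wpM2r ?sqr_ge0// ler_nat.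
  rewrite mulrA expr2 mulrA ler_wpM2r//.
  by rewrite -ler_pdivlMl// mulrC.
have dFE := diff_unique dvc Flin.
have dF : differentiable F y.
  by apply/diff_locallyP; rewrite dFE; split.
split=> //; apply/rowP => i.
rewrite mxE dFE -[LHS]/(dotv v (delta_mx 0 i)) /dotv (bigD1 i)//= mxE !eqxx mulr1.
by rewrite big1 ?addr0// => j ji; rewrite mxE (negbTE ji) andbF mulr0.
Qed.

Lemma gradientD F G y : differentiable F y -> differentiable G y ->
  gradient (fun z => F z + G z) y = gradient F y + gradient G y.
Proof. by move=> dF dG; apply/rowP => i; rewrite !mxE diffD. Qed.

End Gradient.

(** * Bounded sets, diameters and the operator norm *)

Section Bounds.
Context {R : realType}.

Definition ebounded n (A : set 'rV[R]_n) : Prop :=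
  exists M : R, forall u, A u -> enorm u <= M.

Lemma compact_ebounded n (A : set 'rV[R]_n) : A !=set0 -> compact A -> ebounded A.
Proof.
move=> A0 cA.
have [|c _ cM] := @compact_EVT_max _ R (@enorm R n) A A0 cA.
  apply: continuous_subspaceT.
  apply: (@enorm_lipschitz_continuous _ _ _ 1) => u v.
  by rewrite mul1r ler_enorm_sub.
by exists (enorm c) => u Au; apply: cM; rewrite inE.
Qed.

Lemma enormB_le_ediam n (A : set 'rV[R]_n) u v : ebounded A -> A u -> A v ->
  enorm (u - v) <= ediam A.
Proof.
move=> [M AM] Au Av; apply: ub_le_sup; last by exists u => //; exists v.
exists (M + M) => _ [a Aa [b Ab <-]].
by rewrite (le_trans (enormD _ _))// enormN lerD ?AM.
Qed.

Lemma edist_le n (A : set 'rV[R]_n) y u : A u -> Defs.edist A y <= enorm (y - u).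
Proof.
move=> Au; apply: ge_inf; last by exists u.
by exists 0 => _ [v _ <-]; exact: enorm_ge0.
Qed.

Section operator.
Context {n m : nat}.
Variable T : {linear 'rV[R]_n -> 'rV[R]_m}.

(** Any finite constant serves: it shows that the set under the supremum in [opnorm] is bounded, so
    that this supremum is a genuine upper bound. *)
Lemma enorm_linear_le :
  exists K : R, forall u, enorm (T u) <= K * enorm u.
Proof.
exists (\sum_i enorm (T (delta_mx 0 i))) => u.
rewrite {1}(row_sum_delta u) linear_sum mulr_suml.
elim/big_ind2 : _ => [|a b c d|i _]; first by rewrite enorm0.
  by move=> ? ?; rewrite (le_trans (enormD _ _))// lerD.
by rewrite linearZ enormZ mulrC ler_wpM2l ?enorm_ge0// ler_coord_enorm.
Qed.

Lemma enorm_le_opnorm u : enorm (T u) <= opnorm T * enorm u.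
Proof.
have [K TK] := enorm_linear_le.
have ub : has_ubound [set enorm (T x) | x in [set x | enorm x <= 1]].
  exists (`|K|) => _ [v /= v1 <-]; apply: le_trans (TK v) _.
  apply: (@le_trans _ _ (`|K| * enorm v)).
    by rewrite ler_wpM2r ?enorm_ge0 ?ler_norm.
  by rewrite ler_piMr.
have [u0|un0] := eqVneq (enorm u) 0.
  by rewrite u0 mulr0 -(mulr0 K) -u0.
have ugt0 : 0 < enorm u by rewrite lt_neqAle eq_sym un0 enorm_ge0.
rewrite -ler_pdivrMr// mulrC.
rewrite -[X in X * _](@ger0_norm _ (enorm u)^-1) ?invr_ge0 ?enorm_ge0//.
rewrite -enormZ -linearZ/=; apply: ub_le_sup => //.
exists ((enorm u)^-1 *: u) => //=.
by rewrite enormZ ger0_norm ?invr_ge0 ?enorm_ge0// mulVf.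
Qed.

Lemma opnorm_ge0 : 0 <= opnorm T.
Proof.
have [K TK] := enorm_linear_le.
apply: le_trans (enorm_ge0 (T 0)) _; apply: ub_le_sup.
  exists (`|K|) => _ [v /= v1 <-]; apply: le_trans (TK v) _.
  apply: (@le_trans _ _ (`|K| * enorm v)).
    by rewrite ler_wpM2r ?enorm_ge0 ?ler_norm.
  by rewrite ler_piMr.
by exists 0 => //=; rewrite enorm0.
Qed.

Lemma ebounded_image (A : set 'rV[R]_n) : ebounded A -> ebounded (T @` A).
Proof.
move=> [M AM]; exists (opnorm T * M) => _ [u Au <-].
by rewrite (le_trans (enorm_le_opnorm u))// ler_wpM2l ?opnorm_ge0 ?AM.
Qed.

End operator.
End Bounds.

(** * Moreau envelopes *)

(** Let [t] tend to 0. Comparing a minimizer with nearby points of a segment and dividing by [t]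
    leads to this form. *)
Lemma ler_lt1_limit {R : realType} (a b c : R) :
  (forall t, 0 < t -> t < 1 -> a + c * (1 - t) <= b) -> a + c <= b.
Proof.
move=> H; apply/ler_addgt0Pr => e e0.
have d0 : 0 < e + `|c| + 1 by rewrite ltr_wpDl// addr_ge0// ltW.
(* This [t] lies strictly between 0 and 1 and satisfies [c * t <= e]. *)
have t0 : 0 < e / (e + `|c| + 1) by exact: divr_gt0.
have t1 : e / (e + `|c| + 1) < 1.
  by rewrite ltr_pdivrMr// mul1r -addrA ltrDl ltr_wpDl.
have := H _ t0 t1.
have : c * (e / (e + `|c| + 1)) <= e.
  rewrite mulrA ler_pdivrMr// mulrC ler_pM2l//.
  by rewrite (le_trans (ler_norm c))// -addrA addrCA lerDl addr_ge0// ltW.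
by lra.
Qed.

Section Convexity.
Context {R : realType} {n : nat}.
Implicit Types u v : 'rV[R]_n.

Let segmentE u v (t : R) : u + t *: (v - u) = t *: v + (1 - t) *: u.
Proof. by rewrite scalerBl scalerBr scale1r addrCA addrA. Qed.

Lemma convex_set_segment (A : set 'rV[R]_n) u v (t : R) :
  @convex_set R 'rV[R]_n A -> A u -> A v -> 0 <= t <= 1 ->
  A (u + t *: (v - u)).
Proof.
move=> cA Au Av /andP[t0 t1].
have := cA v u (Itv01 t0 t1); rewrite !inE => /(_ Av Au).
by rewrite segmentE.
Qed.

(** Along the segment the squared norm falls below its linear interpolation by exactly
    [t * (1 - t) * enorm (v - u) ^+ 2]; this is the defect left by the quadratic in weak
    convexity. *)
Lemma weakly_convex_segment (rho : R) (h : 'rV[R]_n -> R) u v (t : R) :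
  weakly_convex rho h -> 0 <= t <= 1 ->
  h (u + t *: (v - u)) <=
    (1 - t) * h u + t * h v + rho / 2 * t * (1 - t) * enorm (v - u) ^+ 2.
Proof.
move=> hwc /andP[t0 t1].
have := hwc (Itv01 t0 t1) v u (in_setT _) (in_setT _).
rewrite -[X in X <= _ -> _]/(h (t *: v + (1 - t) *: u) +
  rho / 2 * enorm (t *: v + (1 - t) *: u) ^+ 2) -segmentE.
rewrite -[X in _ <= X -> _]/(t * (h v + rho / 2 * enorm v ^+ 2) +
  (1 - t) * (h u + rho / 2 * enorm u ^+ 2)).
rewrite !enorm_sqr !dotv_linE (dotvC v u).
set a := dotv _ _; set b := dotv _ _; set c := dotv _ _.
by move: (h (u + _)) => hw; lra.
Qed.

End Convexity.

(** * Proximal points and the envelopes they determine *)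

Section ProximalPoint.
Context {R : realType} {m : nat}.
Variables (D : set 'rV[R]_m) (h : 'rV[R]_m -> R).
Implicit Types y z u v : 'rV[R]_m.

(* Both penalties have this shape: [h = 0] in case (I), [D = setT] in case (II). *)
Definition restricted y : \bar R := if y \in D then (h y)%:E else +oo%E.

Definition prox_obj (beta : R) y u : R :=
  h u + (2 * beta)^-1 * enorm (u - y) ^+ 2.

Definition prox_point (beta : R) y u : Prop :=
  D u /\ forall v, D v -> prox_obj beta y u <= prox_obj beta y v.

Lemma moreauE (beta : R) y u : prox_point beta y u ->
  moreau restricted beta y = prox_obj beta y u.
Proof.
move=> [Du umin]; rewrite /moreau.
suff -> : ereal_inf (range (moreau_fun restricted beta y)) =
          (prox_obj beta y u)%:E by [].
apply/eqP; rewrite eq_le; apply/andP; split.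
  apply: ereal_inf_lbound; exists u => //.
  by rewrite /moreau_fun /restricted mem_set.
apply: le_ereal_inf_tmp => _ [v _ <-]; rewrite /moreau_fun /restricted.
by case: ifPn => [/set_mem/umin|_]; rewrite ?leey// -EFinD lee_fin.
Qed.

Variables (Lg rho : R).
Hypotheses (D_neq0 : D !=set0) (D_closed : closed D)
  (D_convex : @convex_set R 'rV[R]_m D) (Lg_ge0 : 0 <= Lg)
  (h_lip : forall y z, `|h y - h z| <= Lg * enorm (y - z))
  (h_wcvx : weakly_convex rho h).

Section fixed_parameter.
Variable beta : R.
Hypotheses (beta_gt0 : 0 < beta) (rho_beta : rho * beta < 1).

(** Coercivity: far from a point [d] of [D] the quadratic outgrows any decrease of the Lipschitz
    function [h], so a minimizer over the compact part of [D] near [d] is global. *)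
Lemma prox_point_exists y : exists u, prox_point beta y u.
Proof.
have [d Dd] := D_neq0.
(* With [a = enorm (d - y)] and [w = enorm (v - d)], the quadratic grows from [d] to [v] by at least
   [w * (w - 2 * a) / (2 * beta)]. This exceeds [Lg * w], the largest possible decrease of [h], once
   [w > r]. *)
pose r := 2 * enorm (d - y) + 2 * beta * Lg.
have r0 : 0 <= r.
  by rewrite /r addr_ge0 ?mulr_ge0 ?enorm_ge0 ?(ltW beta_gt0).
have dist_cts z : continuous (fun u => enorm (u - z)).
  apply: (@enorm_lipschitz_continuous _ _ _ 1) => u v.
  rewrite mul1r (le_trans (ler_enorm_sub _ _))//.
  by rewrite opprB addrA subrK.
pose K := D `&` (fun u => enorm (u - d)) @^-1` [set x | x <= r].
have cK : compact K.
  apply: bounded_closed_compact.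
    exists (r + enorm d); split; first exact: num_real.
    move=> M rM u [_ /= ur]; apply: le_trans (norm_le_enorm u) _.
    by have := enormD (u - d) d; rewrite subrK; lra.
  apply: closedI => //; apply: preimage_closed; last exact: closed_le.
  by move=> ? _; exact: dist_cts.
have Kd : K d by split=> //=; rewrite subrr enorm0.
have objc : {within K, continuous (prox_obj beta y)}.
  apply: continuous_subspaceT => u.
  have hc : continuous h := enorm_lipschitz_continuous h_lip.
  apply: (@cvgD _ _ _ (nbhs u) (nbhs_filter u)); first exact: hc.
  apply: cvgM; first exact: cvg_cst.
  by under eq_fun do rewrite expr2; rewrite expr2; apply: cvgM; exact: dist_cts.
have [|u uK umin] := @compact_EVT_min _ R (prox_obj beta y) K _ cK objc.
  by exists d.
exists u; split; first by case: (set_mem uK).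
move=> v Dv; have [vr|rv] := leP (enorm (v - d)) r.
  by apply: umin; rewrite inE; split.
apply: (le_trans (umin d (mem_set Kd))); rewrite /prox_obj.
have hdv : h d - h v <= Lg * enorm (v - d).
  by rewrite enormB (le_trans _ (h_lip _ _))// ler_norm.
have := enormD (v - y) (y - d); rewrite addrA subrK (enormB y d) => tri.
rewrite -subr_ge0.
have i0 : 0 < (2 * beta)^-1 by rewrite invr_gt0 mulr_gt0.
have ib : (2 * beta)^-1 * (2 * beta) = 1 by rewrite mulVf// gt_eqF// mulr_gt0.
set e := (2 * beta)^-1 in i0 ib *; set X := enorm (v - y) in tri *.
set a := enorm (d - y) in tri *; set w := enorm (v - d) in tri rv hdv *.
have a0 : 0 <= a := enorm_ge0 _.
have w0 : 0 <= w := enorm_ge0 _.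
have rE : r = 2 * a + 2 * beta * Lg by [].
have aw : a <= w.
  by have := mulr_ge0 (mulr_ge0 (ler0n R 2) (ltW beta_gt0)) Lg_ge0; lra.
have : (w - a) ^+ 2 <= X ^+ 2.
  by rewrite ler_pXn2r ?nnegrE ?enorm_ge0 ?subr_ge0//; lra.
have : e * (w * (2 * a + 2 * beta * Lg)) <= e * (w * w).
  by rewrite ler_pM2l// ler_wpM2l// ltW.
have -> : e * (w * (2 * a + 2 * beta * Lg)) =
   2 * e * w * a + (e * (2 * beta)) * w * Lg by ring.
rewrite ib mul1r => H /(ler_wpM2l (ltW i0)) H2.
by nra.
Qed.

(** Minimality of [u] is tested at the point a fraction [t] of the way to [v]. Strong convexity of
    the objective along the segment leaves a factor [1 - t] after division by [t], removed in the
    limit. *)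
Lemma prox_point_growth y u v : prox_point beta y u -> D v ->
  prox_obj beta y u + (beta^-1 - rho) / 2 * enorm (v - u) ^+ 2
    <= prox_obj beta y v.
Proof.
move=> [Du umin] Dv.
set c := (_ / 2 * _).
suff H (t : R) : 0 < t -> t < 1 ->
    prox_obj beta y u + c * (1 - t) <= prox_obj beta y v.
  exact: ler_lt1_limit.
move=> t0 t1.
have t01 : 0 <= t <= 1 by rewrite !ltW.
have := umin _ (convex_set_segment D_convex Du Dv t01).
have := weakly_convex_segment u v h_wcvx t01.
have -> : prox_obj beta y (u + t *: (v - u)) = h (u + t *: (v - u)) +
  (2 * beta)^-1 * ((1 - t) * enorm (u - y) ^+ 2 + t * enorm (v - y) ^+ 2 -
    t * (1 - t) * enorm (v - u) ^+ 2).
  rewrite /prox_obj !enorm_sqr !dotv_linE (dotvC v u) (dotvC y u) (dotvC y v).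
  by congr (_ + _ * _); ring.
move: (h (u + _)) => hw; rewrite /prox_obj /c invfM.
move: (enorm (v - u) ^+ 2) (enorm (u - y) ^+ 2) (enorm (v - y) ^+ 2) => X Y Z.
move=> H1 H2.
rewrite -(ler_pM2l t0); lra.
Qed.

(** The candidate [u], optimal for [y], is tested in the problem at [z]; expanding its squared
    distance to [z] around [y] produces the right-hand side exactly. *)
Lemma moreau_upper y z u : prox_point beta y u ->
  moreau restricted beta z <= moreau restricted beta y +
    dotv (beta^-1 *: (y - u)) (z - y) + (2 * beta)^-1 * enorm (z - y) ^+ 2.
Proof.
move=> yu; have [w zw] := prox_point_exists z.
rewrite (moreauE yu) (moreauE zw); apply: le_trans (zw.2 u yu.1) _.
rewrite /prox_obj !enorm_sqr !dotv_linE (dotvC y u) (dotvC z u) (dotvC z y).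
by rewrite invfM; lra.
Qed.

(** The growth inequality at [y] is applied to the proximal point [w] of [z]. Since [w - u] is
    unknown, the resulting quadratic in it is bounded by its minimum, which yields the constant. *)
Lemma moreau_lower y z u : prox_point beta y u ->
  moreau restricted beta y + dotv (beta^-1 *: (y - u)) (z - y) -
    beta^-1 ^+ 2 / (2 * (beta^-1 - rho)) * enorm (z - y) ^+ 2
  <= moreau restricted beta z.
Proof.
move=> yu; have [w zw] := prox_point_exists z.
rewrite (moreauE yu) (moreauE zw).
have mu0 : 0 < beta^-1 - rho.
  by rewrite subr_gt0 -[beta^-1]mul1r ltr_pdivlMr.
have := prox_point_growth yu zw.1.
rewrite /prox_obj (_ : w - z = (w - u) + (u - y) + (y - z)); last first.
  by rewrite !addrA !subrK.
rewrite (_ : w - y = (w - u) + (u - y)); last by rewrite addrA subrK.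
rewrite -(opprB u y) -(opprB y z) enormN.
move: (w - u) (u - y) (y - z) => a c d.
have bE := mulr_ge0 (ltW (divr_gt0 ltr01 beta_gt0)) (dotvv_ge0 d).
(* completes the square in [a = w - u], the displacement of the proximal point *)
have := dotvv_ge0 ((beta^-1 - rho) *: a + beta^-1 *: d).
rewrite scalerN dotvNl dotvNr opprK !enorm_sqr !dotv_linE.
rewrite (dotvC d a) (dotvC c a) (dotvC d c) invfM.
set mu := beta^-1 - rho in mu0 *; set b := beta^-1.
move: bE; rewrite div1r -/b; move: (dotv a a) (dotv c c) (dotv d d) => A B E bE.
move: (dotv a d) (dotv c d) (dotv a c) => x1 x2 x3 H1 H2.
have m0 : 0 < (2 * mu)^-1 by rewrite invr_gt0 mulr_gt0.
suff : 0 <= mu / 2 * A + b * x1 + b ^+ 2 / (2 * mu) * E.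
  by rewrite invfM; lra.
have := mulr_ge0 (ltW m0) H1; congr (_ <= _).
by field; rewrite gt_eqF.
Qed.

Lemma moreau_differentiable_gradient y u : prox_point beta y u ->
  differentiable (moreau restricted beta) y /\
  gradient (moreau restricted beta) y = beta^-1 *: (y - u).
Proof.
move=> yu; apply: (@gradient_of_quadratic_bound _ _ _ _ _
  (* The sum of the upper and lower coefficients bounds the remainder on both sides. *)
  ((2 * beta)^-1 + beta^-1 ^+ 2 / (2 * (beta^-1 - rho)))) => z.
have := moreau_lower z yu; have := moreau_upper z yu.
have b0 : 0 <= (2 * beta)^-1 by rewrite invr_ge0 mulr_ge0// ltW.
have K0 : 0 <= beta^-1 ^+ 2 / (2 * (beta^-1 - rho)).
  rewrite divr_ge0 ?sqr_ge0// mulr_ge0// subr_ge0 -[beta^-1]mul1r.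
  by rewrite ler_pdivlMr// ltW.
have := mulr_ge0 b0 (sqr_ge0 (enorm (z - y))).
have := mulr_ge0 K0 (sqr_ge0 (enorm (z - y))).
by move=> ? ? ? ?; rewrite mulrDl ler_norml; apply/andP; split; lra.
Qed.

End fixed_parameter.

(** The objective decreases pointwise in the parameter, so the proximal point for [b] is a good
    enough candidate for [b']. *)
Lemma moreau_antitone (b b' : R) y : 0 < b -> b <= b' -> rho * b' < 1 ->
  0 <= rho -> moreau restricted b' y <= moreau restricted b y.
Proof.
move=> b0 bb' rb' rho0.
have b'0 : 0 < b' by exact: lt_le_trans bb'.
have rb : rho * b < 1 by apply: le_lt_trans rb'; rewrite ler_wpM2l.
have [u yu] := prox_point_exists b0 y; have [u' yu'] := prox_point_exists b'0 y.
rewrite (moreauE yu) (moreauE yu') (le_trans (yu'.2 u yu.1))//.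
rewrite lerD2l ler_wpM2r ?sqr_ge0// lef_pV2 ?posrE ?mulr_gt0//.
by rewrite ler_pM2l.
Qed.

(** At the candidate [u'] the two objectives differ only in the weight of the quadratic. *)
Lemma moreau_increment (b b' : R) y u' : 0 < b -> 0 < b' ->
  prox_point b' y u' ->
  moreau restricted b y <= moreau restricted b' y +
    (b^-1 - b'^-1) / 2 * enorm (y - u') ^+ 2.
Proof.
move=> b0 b'0 yu'; have [u yu] := prox_point_exists b0 y.
rewrite (moreauE yu) (moreauE yu') (le_trans (yu.2 u' yu'.1))//.
by rewrite /prox_obj enormB !invfM; lra.
Qed.

End ProximalPoint.

(** * Mean value estimates along segments of a convex set *)

Section SegmentCalculus.
Context {R : realType} {n : nat}.
Variables (C : set 'rV[R]_n) (F : 'rV[R]_n -> R).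
Hypotheses (C_convex : @convex_set R 'rV[R]_n C)
  (F_diff : forall x, C x -> differentiable F x).
Implicit Types x y : 'rV[R]_n.

Lemma is_derive_segment x y (t : R) : C x -> C y -> 0 <= t <= 1 ->
  is_derive t 1 (fun t : R => F (x + t *: (y - x)))
    (dotv (gradient F (x + t *: (y - x))) (y - x)).
Proof.
move=> Cx Cy t01.
pose a := fun t : R => x + t *: (y - x).
have da : is_diff t a ( *:%R ^~ (y - x)).
  rewrite -[X in is_diff _ _ X]add0r.
  by apply: is_diffD; exact: is_diff_cst.
have Cat : C (a t) by exact: convex_set_segment.
have dFa : differentiable (F \o a) t.
  by apply: differentiable_comp => //; exact: F_diff.
split; first exact: diff_derivable.
rewrite deriveE// -[X in 'd X t]/(F \o a) diff_comp//; last exact: F_diff.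
by rewrite /= diff_val scale1r dotv_gradient.
Qed.

Lemma segment_continuous x y : C x -> C y ->
  {within `[0, 1], continuous (fun t : R => F (x + t *: (y - x)))}.
Proof.
move=> Cx Cy; apply: derivable_within_continuous => t t01.
exact: (@ex_derive _ _ _ _ _ _ _ (is_derive_segment Cx Cy _)).
Qed.

Lemma le_gradient_bound x y (M : R) : C x -> C y ->
  (forall z, C z -> enorm (gradient F z) <= M) ->
  F y - F x <= M * enorm (y - x).
Proof.
move=> Cx Cy CM.
have der (t : R) : t \in `]0, 1[%R ->
    is_derive t 1 (fun t : R => F (x + t *: (y - x)))
      (dotv (gradient F (x + t *: (y - x))) (y - x)).
  by move=> /andP[t0 t1]; apply: is_derive_segment => //; rewrite !ltW.
have [t t01] := MVT_segment ler01 der (segment_continuous Cx Cy).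
rewrite scale1r scale0r addr0 subrKC subr0 mulr1 => ->.
apply: le_trans (dotv_le _ _) _.
rewrite ler_wpM2r ?enorm_ge0 ?CM//; exact: convex_set_segment.
Qed.

Lemma descent x y (L : R) : C x -> C y -> elipschitz_on C L (gradient F) ->
  F y <= F x + dotv (gradient F x) (y - x) + L / 2 * enorm (y - x) ^+ 2.
Proof.
move=> Cx Cy FL.
pose a := dotv (gradient F x) (y - x); pose b := L / 2 * enorm (y - x) ^+ 2.
pose G := fun t : R => F (x + t *: (y - x)) - (a * t + b * (t * t)).
pose dG := fun t : R => dotv (gradient F (x + t *: (y - x))) (y - x) -
   (a + b * (2 * t)).
have der (t : R) : 0 <= t <= 1 -> is_derive t 1 G (dG t).
  move=> t01; apply: is_deriveB; first exact: is_derive_segment.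
  by apply: is_derive_eq; rewrite /GRing.scale/=; ring.
have Gc : {within `[0, 1], continuous G}.
  by apply: derivable_within_continuous => t /der dGt; exact: ex_derive.
have der' (t : R) : t \in `]0, 1[%R -> is_derive t 1 G (dG t).
  by move=> /andP[t0 t1]; apply: der; rewrite !ltW.
have [t t01] := MVT_segment ler01 der' Gc.
rewrite /G /dG scale1r scale0r addr0 subrKC subr0 !mulr1 !mulr0 addr0 subr0.
have /andP[t0 t1] : 0 <= t <= 1 by [].
have : dotv (gradient F (x + t *: (y - x)) - gradient F x) (y - x) <=
    L * t * enorm (y - x) ^+ 2.
  apply: le_trans (dotv_le _ _) _; rewrite expr2 mulrA ler_wpM2r ?enorm_ge0//.
  apply: le_trans (FL _ _ _ Cx) _; first exact: convex_set_segment.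
  by rewrite addrC addKr enormZ ger0_norm// mulrA.
rewrite /a /b; move: (x + t *: (y - x)) (gradient F) => z gF.
rewrite dotvDl dotvNl; move: (dotv (gF z) _) (dotv (gF x) _) => d c H E.
by lra.
Qed.

End SegmentCalculus.

(** * Proximal displacements in the two penalty cases *)

Section Penalties.
Context {R : realType} {m : nat}.
Implicit Types (D : set 'rV[R]_m) (h : 'rV[R]_m -> R) (y u : 'rV[R]_m).

(** With a zero function the proximal point is a projection: minimality compares distances
    directly. *)
Lemma prox_point_edist D (beta : R) y u : 0 < beta ->
  prox_point D (fun=> 0) beta y u -> enorm (y - u) <= Defs.edist D y.
Proof.
move=> beta0 [Du umin]; apply: lb_le_inf; first by exists (enorm (y - u)), u.
move=> _ [v Dv <-]; have := umin v Dv; rewrite /prox_obj !add0r.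
rewrite ler_pM2l ?invr_gt0 ?mulr_gt0//.
by rewrite ler_pXn2r ?nnegrE ?enorm_ge0// (enormB u) (enormB v).
Qed.

(** Moving [u] a fraction [t] towards [y] raises [h] by at most [Lg * t * d], where
    [d = enorm (y - u)], and lowers the quadratic by [t * (2 - t) * d ^ 2 / (2 * beta)]. *)
Lemma prox_point_lipschitz h (Lg beta : R) y u : 0 < beta -> 0 <= Lg ->
  (forall y z, `|h y - h z| <= Lg * enorm (y - z)) ->
  prox_point setT h beta y u -> enorm (y - u) <= beta * Lg.
Proof.
move=> beta0 Lg0 hL [_ umin].
have [d0|dn0] := eqVneq (enorm (y - u)) 0.
  by rewrite d0 mulr_ge0 ?(ltW beta0).
have dgt0 : 0 < enorm (y - u) by rewrite lt_neqAle eq_sym dn0 enorm_ge0.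
rewrite -ler_pdivrMl//.
(* The two halves match the splitting [2 - t = 1 + (1 - t)]. *)
rewrite [leLHS](_ : _ = (2 * beta)^-1 * enorm (y - u) +
  (2 * beta)^-1 * enorm (y - u)); last by field; rewrite gt_eqF.
apply: ler_lt1_limit => t t0 t1.
have := umin (u + t *: (y - u)) I; rewrite /prox_obj.
have -> : u + t *: (y - u) - y = (t - 1) *: (y - u).
  by rewrite scalerBl scale1r opprB addrCA addrA.
have := hL (u + t *: (y - u)) u.
rewrite (addrC u (t *: _)) addrK => /(le_trans (ler_norm _)).
rewrite !enormZ (gtr0_norm t0) ltr0_norm ?subr_lt0// opprB (enormB u y).
move: (h (_ + u)) (h u) => w w'.
move: (enorm (y - u)) dgt0 => d d0 H1 H2.
rewrite -(ler_pM2l t0) -(ler_pM2r d0).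
by lra.
Qed.

(** Both cases are brought to one form, so that the rest of the argument sees [Bprox] only as a
    bound on proximal displacements from points of [TC]. *)
Lemma penalty_as_restricted (TC : set 'rV[R]_m) (g : 'rV[R]_m -> \bar R)
    (rho Bprox beta0 : R) : ebounded TC ->
  penalty_caseI TC g rho Bprox \/ penalty_caseII beta0 g rho Bprox ->
  exists D h (Lg : R),
    [/\ [/\ D !=set0, closed D & @convex_set R 'rV[R]_m D],
        [/\ 0 <= Lg, forall y z, `|h y - h z| <= Lg * enorm (y - z),
            0 <= rho & weakly_convex rho h],
        g = restricted D h &
        forall beta y u, 0 < beta <= beta0 -> TC y ->
          prox_point D h beta y u -> enorm (y - u) <= Bprox].
Proof.
move=> [M TCM] [[D [D0 Dcl Dcvx gE [rhoE BE]]]|[h [Lg [gE Lg0 hL [rho0 wc] BE]]]].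
  exists D, (fun=> 0), 0; split=> //.
  - split=> //.
    + by move=> y z; rewrite subrr normr0 mul0r.
    + by rewrite rhoE.
    + rewrite /weakly_convex (_ : (fun y => _) = cst 0); last first.
        by apply/funext => y; rewrite rhoE !mul0r addr0.
      by move=> t u v _ _; rewrite /= convmm.
  - move=> beta y u /andP[beta0' _] TCy yu; rewrite BE.
    apply: le_trans (prox_point_edist beta0' yu) _.
    apply: ub_le_sup; last by exists y.
    (* Distances to one fixed point of [D] bound the set of values of [edist], so its supremum is an
       upper bound. *)
    have [d Dd] := D0.
    exists (M + enorm d) => _ [z TCz <-].
    rewrite (le_trans (edist_le _ Dd))// (le_trans (enormD _ _))// enormN.
    by rewrite lerD2r TCM.
exists setT, h, Lg; split=> //.
- by split=> //; exists 0.
- by rewrite gE; apply: funext => y; rewrite /restricted in_setT.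
- move=> beta y u /andP[beta0' bb] _ /(prox_point_lipschitz beta0' Lg0 hL).
  by move=> /le_trans; apply; rewrite BE ler_wpM2r.
Qed.

End Penalties.

Lemma ltr_inver_mul {R : realType} (rho beta0 : R) : 0 <= rho ->
  (beta0%:E < (rho%:E)^-1)%E -> rho * beta0 < 1.
Proof.
rewrite inver; case: eqVneq => [->|rho0 rho_ge0]; first by rewrite mul0r.
by rewrite lte_fin mulrC -ltr_pdivlMr ?mul1r// lt_neqAle eq_sym rho0.
Qed.

(** * Sums *)

Lemma powR_ge1 {R : realType} (k : nat) (r : R) : 0 <= r -> 1 <= k.+1%:R `^ r.
Proof.
by have := @ler_powR R k.+1%:R; rewrite ler1n => /(_ isT 0 r); rewrite powRr0.
Qed.

Lemma divN_powR_le {R : realType} (N : nat) (e r : R) : (1 <= N)%N ->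
  e - 1 <= - r -> N%:R^-1 * N%:R `^ e <= N%:R `^ (- r).
Proof.
move=> N1 er.
have N0 : (N%:R : R) != 0 by rewrite pnatr_eq0 -lt0n.
rewrite mulrC -powR_inv1// -powRD; last by rewrite N0 implybT.
by rewrite ler_powR// ler1n.
Qed.

Section Sums.
Context {R : realType}.

(* Abel summation: the increments of [a] only ever multiply the nonnegative
   gaps [V k - w k], so a moving upper bound [V] may replace a constant one. *)
Lemma weighted_telescope (a u w V : nat -> R) N :
  (forall k, 0 <= a k <= a k.+1) -> u 0%N <= V 0%N ->
  (forall k, 0 <= V k - w k <= V k.+1 - u k.+1) ->
  \sum_(0 <= k < N.+1) a k * (u k - w k) <= a N * (V N - w N).
Proof.
move=> a_incr uV0 gap_incr; elim: N => [|N IH].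
  rewrite big_nat1; have /andP[a0 _] := a_incr 0%N.
  by rewrite ler_wpM2l// lerD2r.
rewrite big_nat_recr//=.
have /andP[aN aNS] := a_incr N; have /andP[vN vNS] := gap_incr N.
(* This product passes from the bound at [N] to [a N.+1 * (V N.+1 - u N.+1)]; the new summand then
   replaces [u N.+1] by [w N.+1]. *)
have := ler_pM aN vN aNS vNS.
by move: IH; lra.
Qed.

(** One telescoping step for the power sum, in place of a comparison with the integral of
    [t ^ (- r)]. *)
Lemma powR_step_le (r : R) k : 0 < r < 1 ->
  k%:R `^ (1 - r) + (1 - r) * k.+1%:R `^ (- r) <= k.+1%:R `^ (1 - r).
Proof.
move=> /andP[r0 r1]; have s0 : 0 < 1 - r by rewrite subr_gt0.
have k0 : 0 < k.+1%:R :> R by [].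
(* Young's inequality for [k ^ (1 - r) * (k + 1) ^ r] *)
have := @conjugate_powR R (k%:R `^ (1 - r)) (k.+1%:R `^ r) (1 - r)^-1 r^-1.
rewrite !powR_ge0 !invr_gt0 s0 r0 !invrK subrK => /(_ isT isT isT isT erefl).
rewrite -!powRrM !divff ?gt_eqF// !powRr1// => H.
have kr : 0 < k.+1%:R `^ r :> R by exact: powR_gt0.
rewrite -(ler_pM2r kr) mulrDl -mulrA -!powRD ?(gt_eqF k0) ?implybT//.
rewrite addNr powRr0 subrK powRr1// mulr1.
by apply: (le_trans (lerD H (lexx _))); rewrite -natr1; lra.
Qed.

Lemma sum_powRN_le (r : R) N : 0 < r < 1 ->
  \sum_(0 <= k < N) k.+1%:R `^ (- r) <= N%:R `^ (1 - r) / (1 - r).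
Proof.
move=> r01; have /andP[r0 r1] := r01.
have s0 : 0 < 1 - r by rewrite subr_gt0.
rewrite ler_pdivlMr//; elim: N => [|N IH].
  by rewrite big_nil mul0r powR_ge0.
rewrite big_nat_recr//= mulrDl.
by have := powR_step_le N r01; move: IH; lra.
Qed.

Lemma min_upto_le (a : nat -> R) N k : (k < N)%N -> min_upto a N <= a k.
Proof. by move=> kN; rewrite /min_upto big_mkord (bigmin_le _ (Ordinal kN)). Qed.

Lemma min_upto_le_avg (a : nat -> R) N : (0 < N)%N ->
  min_upto a N <= avg_upto a N.
Proof.
move=> N0; rewrite /avg_upto -ler_pdivrMl ?invr_gt0 ?ltr0n// invrK.
rewrite mulr_natl -[X in _ *+ X]subn0 -sumr_const_nat.
by apply: ler_sum_nat => k /andP[_ kN]; exact: min_upto_le.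
Qed.

Lemma min_upto_ge0 (a : nat -> R) N : (forall k, 0 <= a k) -> 0 <= min_upto a N.
Proof.
move=> a0; rewrite /min_upto; elim/big_ind: _ => // x y x0 y0.
by rewrite le_min x0.
Qed.

Lemma avg_upto_ge0 (a : nat -> R) N : (forall k, 0 <= a k) -> 0 <= avg_upto a N.
Proof. by move=> a0; rewrite mulr_ge0// sumr_ge0. Qed.

End Sums.

Section LinearComposition.
Context {R : realType} {n m : nat}.
Variable T : {linear 'rV[R]_n -> 'rV[R]_m}.

Lemma linear_enorm_continuous : continuous T.
Proof.
apply: (@enorm_lipschitz_continuous _ _ _ (opnorm T)) => u v.
by rewrite -raddfB (le_trans (norm_le_enorm _))// enorm_le_opnorm.
Qed.

Lemma differentiable_gradient_comp_linear (F : 'rV[R]_m -> R) x :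
  differentiable F (T x) ->
  differentiable (F \o T) x /\
  gradient (F \o T) x = adjoint T (gradient F (T x)).
Proof.
move=> dF.
have Tc := linear_enorm_continuous.
have dT : differentiable T x := @linear_differentiable _ _ _ T x Tc.
split; first exact: differentiable_comp.
apply/rowP => i.
rewrite mxE diff_comp//= (@diff_lin _ _ _ T x Tc)/= -dotv_gradient dotvC dotv_adjoint.
rewrite /dotv (bigD1 i)//= mxE !eqxx mul1r.
by rewrite big1 ?addr0// => j ji; rewrite mxE (negbTE ji) andbF mul0r.
Qed.

Lemma convex_set_image (A : set 'rV[R]_n) :
  @convex_set R 'rV[R]_n A -> @convex_set R 'rV[R]_m (T @` A).
Proof.
move=> cA u v t /set_mem[a Aa <-] /set_mem[b Ab <-]; apply/mem_set.
exists (t%:num *: a + (1 - t%:num) *: b).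
  by apply: set_mem; apply: (cA a b t); exact: mem_set.
by rewrite linearD !linearZ.
Qed.

End LinearComposition.

(** * The Frank-Wolfe iteration *)

Section FrankWolfeStep.
Context {R : realType} {n m : nat}.
Variables (C : set 'rV[R]_n) (f : 'rV[R]_n -> R) (L : R)
  (T : {linear 'rV[R]_n -> 'rV[R]_m}) (D : set 'rV[R]_m) (h : 'rV[R]_m -> R)
  (Lg rho Bprox beta0 : R).
Hypotheses (C_neq0 : C !=set0) (C_compact : compact C)
  (C_convex : @convex_set R 'rV[R]_n C)
  (f_diff : forall x, C x -> differentiable f x)
  (L_gt0 : 0 < L) (f_smooth : elipschitz_on C L (gradient f))
  (D_neq0 : D !=set0) (D_closed : closed D)
  (D_convex : @convex_set R 'rV[R]_m D) (Lg_ge0 : 0 <= Lg)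
  (h_lip : forall y z, `|h y - h z| <= Lg * enorm (y - z))
  (rho_ge0 : 0 <= rho) (h_wcvx : weakly_convex rho h)
  (beta0_gt0 : 0 < beta0) (rho_beta0 : rho * beta0 < 1)
  (prox_dist : forall beta y u, 0 < beta <= beta0 -> (T @` C) y ->
    prox_point D h beta y u -> enorm (y - u) <= Bprox).

Local Notation g := (restricted D h).
Local Notation B := (constB C T Bprox).

Let C_bounded : ebounded C := compact_ebounded C_neq0 C_compact.

Let TC_bounded : ebounded (T @` C) := ebounded_image T C_bounded.

Let rho_beta (beta : R) : 0 < beta <= beta0 -> rho * beta < 1.
Proof. by move=> /andP[_ ?]; apply: le_lt_trans rho_beta0; rewrite ler_wpM2l. Qed.

Let prox_exists (beta : R) y : 0 < beta <= beta0 ->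
  exists u, prox_point D h beta y u.
Proof.
by move=> /andP[b0 _]; exact: (prox_point_exists D_neq0 D_closed Lg_ge0 h_lip).
Qed.

Lemma moreau_differentiable (beta : R) y : 0 < beta <= beta0 ->
  differentiable (moreau g beta) y.
Proof.
move=> bb; have [u yu] := prox_exists y bb; have /andP[b0 _] := bb.
by have [] := moreau_differentiable_gradient D_neq0 D_closed D_convex Lg_ge0
  h_lip h_wcvx b0 (rho_beta bb) yu.
Qed.

(** [Bprox] is known only through [prox_dist], so its sign is read off from one proximal point. *)
Lemma Bprox_ge0 : 0 <= Bprox.
Proof.
have [x Cx] := C_neq0.
have bb : 0 < beta0 <= beta0 by rewrite beta0_gt0 lexx.
have [u xu] := prox_exists (T x) bb.
by rewrite (le_trans (enorm_ge0 _) (prox_dist bb _ xu))//; exists x.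
Qed.

Lemma constB_ge0 : 0 <= B.
Proof. by rewrite /constB le_max divr_ge0 ?sqr_ge0. Qed.

Lemma ediam_ge0 : 0 <= ediam C.
Proof.
have [x Cx] := C_neq0.
by rewrite (le_trans (enorm_ge0 _) (enormB_le_ediam C_bounded Cx Cx)).
Qed.

Lemma moreau_oscillation y z : (T @` C) y -> (T @` C) z ->
  moreau g beta0 z - moreau g beta0 y <= B / beta0.
Proof.
move=> TCy TCz.
have bb : 0 < beta0 <= beta0 by rewrite beta0_gt0 lexx.
have := @le_gradient_bound _ _ _ _ (@convex_set_image _ _ _ T _ C_convex)
  (fun y _ => moreau_differentiable y bb) y z (Bprox / beta0) TCy TCz.
move=> /(_ _)/le_trans; apply.
  move=> w TCw; have [u wu] := prox_exists w bb.
  have [_ ->] := moreau_differentiable_gradient D_neq0 D_closed D_convex Lg_ge0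
    h_lip h_wcvx beta0_gt0 rho_beta0 wu.
  rewrite enormZ gtr0_norm ?invr_gt0// mulrC ler_pM2r ?invr_gt0//.
  exact: prox_dist wu.
rewrite mulrAC ler_pM2r ?invr_gt0// /constB le_max; apply/orP; right.
by rewrite ler_wpM2l ?Bprox_ge0// enormB_le_ediam.
Qed.

Lemma moreau_increment_le (b b' : R) y : 0 < b <= b' -> b' <= beta0 ->
  (T @` C) y ->
  moreau g b y <= moreau g b' y + B * (b^-1 - b'^-1).
Proof.
move=> /andP[b0 bb'] b'b TCy.
have b'0 : 0 < b' by exact: lt_le_trans bb'.
have bb : 0 < b' <= beta0 by rewrite b'0.
have [u yu] := prox_exists y bb.
have := moreau_increment D_neq0 D_closed Lg_ge0 h_lip b0 b'0 yu.
move=> /le_trans; apply; rewrite lerD2l mulrAC -mulrA mulrC.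
have bi : 0 <= b^-1 - b'^-1 by rewrite subr_ge0 lef_pV2.
(* Here the first entry of the maximum, half of [Bprox ^+ 2], is used. *)
rewrite ler_wpM2r// /constB le_max; apply/orP; left.
rewrite ler_pM2r// ler_pXn2r ?nnegrE ?enorm_ge0 ?Bprox_ge0//.
exact: prox_dist yu.
Qed.

Lemma lip_f_oscillation x y : C x -> C y -> f y - f x <= lip_f C f * ediam C.
Proof.
move=> Cx Cy.
have ub z : C z -> enorm (gradient f z) <= lip_f C f.
  move=> Cz; apply: ub_le_sup; last by exists z.
  (* Lipschitz continuity from the single point [x] bounds all gradients on [C], so the supremum
     [lip_f] is finite. *)
  exists (L * ediam C + enorm (gradient f x)) => _ [w Cw <-].
  have := enormD (gradient f w - gradient f x) (gradient f x).
  rewrite subrK => /le_trans; apply; rewrite lerD2r.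
  apply: le_trans (f_smooth Cw Cx) _.
  by rewrite ler_pM2l// enormB_le_ediam.
apply: le_trans (le_gradient_bound C_convex f_diff Cx Cy ub) _.
rewrite ler_wpM2l ?enormB_le_ediam// (le_trans (enorm_ge0 _) (ub x Cx))//.
Qed.

Section step.
Variables (beta gamma : R) (x s : 'rV[R]_n).
Hypotheses (beta_in : 0 < beta <= beta0) (gamma_in : 0 < gamma <= 1) (Cx : C x)
  (s_min : linear_argmin C (gradient (smoothed_obj f T g beta) x) s).

Let v := gradient f x + adjoint T (gradient (moreau g beta) (T x)).

Let gradient_smoothed : gradient (smoothed_obj f T g beta) x = v.
Proof.
have [dgT gE] := differentiable_gradient_comp_linear
  (moreau_differentiable (T x) beta_in).
by rewrite /v -gE -gradientD//; exact: f_diff.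
Qed.

(** The linear minimizer [s] attains the supremum defining the gap. *)
Let gap_ub : ubound [set dotv v (x - z) | z in C] (dotv v (x - s)).
Proof.
move=> _ [z Cz <-]; have [_ /(_ z Cz)] := s_min.
by rewrite gradient_smoothed !dotvDr !dotvNr lerD2l lerN2.
Qed.

Lemma gap_ge0 : 0 <= gap C f T g beta x.
Proof.
apply: ub_le_sup; first by exists (dotv v (x - s)).
by exists x => //; rewrite subrr -(scale0r x) dotvZr mul0r.
Qed.

Lemma gap_le_decrease :
  gap C f T g beta x <=
    gamma^-1 * (smoothed_obj f T g beta x -
                smoothed_obj f T g beta (x + gamma *: (s - x))) +
    gamma * (ediam C ^+ 2 / 2 * (L + opnorm T ^+ 2 / beta)).
Proof.
have /andP[gamma0 gamma1] := gamma_in; have /andP[b0 _] := beta_in.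
have Cs : C s by case: s_min.
have gap_le : gap C f T g beta x <= dotv v (x - s).
  by apply: ge_sup gap_ub; exists (dotv v (x - x)), x.
apply: le_trans gap_le _.
have Cx' : C (x + gamma *: (s - x)).
  by apply: convex_set_segment => //; rewrite ltW.
have Df := descent C_convex f_diff Cx Cx' f_smooth.
have [u xu] := prox_exists (T x) beta_in.
have Dg := moreau_upper D_neq0 D_closed Lg_ge0 h_lip b0
  (T (x + gamma *: (s - x))) xu.
have [_ gE] := moreau_differentiable_gradient D_neq0 D_closed D_convex Lg_ge0
    h_lip h_wcvx b0 (rho_beta beta_in) xu.
have TE : T (x + gamma *: (s - x)) - T x = gamma *: T (s - x).
  by rewrite -linearB addrC addKr linearZ.
have xE : x + gamma *: (s - x) - x = gamma *: (s - x) by rewrite addrC addKr.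
move: Df Dg; rewrite -gE TE xE !enormZ gtr0_norm// !dotvZr.
(* The adjoint moves [T] onto the gradient, so both linear terms pair with [s - x] and add up to
   [dotv v (s - x)]. *)
rewrite (dotvC _ (T _)) dotv_adjoint (dotvC (s - x)) => Df Dg.
have TD : enorm (T (s - x)) ^+ 2 <= opnorm T ^+ 2 * ediam C ^+ 2.
  rewrite -exprMn ler_pXn2r ?nnegrE ?mulr_ge0 ?enorm_ge0 ?opnorm_ge0 ?ediam_ge0//.
  apply: le_trans (enorm_le_opnorm T _) _.
  by rewrite ler_wpM2l ?opnorm_ge0// enormB_le_ediam.
have CD : enorm (s - x) ^+ 2 <= ediam C ^+ 2.
  by rewrite ler_pXn2r ?nnegrE ?enorm_ge0 ?ediam_ge0// enormB_le_ediam.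
rewrite /smoothed_obj -opprB dotvNr /v dotvDl.
move: Df Dg; rewrite !exprMn.
move: (dotv _ _) (dotv _ _) (f _) (f _) (moreau _ _ _) (moreau _ _ _).
move=> d1 d2 f1 f0 m1 m0 Df Dg.
rewrite -(ler_pM2l gamma0) mulrDr mulVKf ?gt_eqF//.
have g2 : 0 < gamma ^+ 2 by exact: exprn_gt0.
have := ler_wpM2l (ltW (mulr_gt0 (divr_gt0 L_gt0 (ltr0n R 2)) g2)) CD.
have b2 : 0 < (2 * beta)^-1 by rewrite invr_gt0 mulr_gt0.
have := ler_wpM2l (ltW (mulr_gt0 b2 g2)) TD.
move: Df Dg; rewrite invfM.
move: (enorm _ ^+ 2) (enorm _ ^+ 2) (ediam C ^+ 2) (opnorm T ^+ 2) => X1 X2 X3 X4.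
by lra.
Qed.

End step.

Section run.
Variables (p q : R) (x s : nat -> 'rV[R]_n).
Hypotheses (p_in : 0 < p < 1) (q_gt0 : 0 < q) (q_lt_p : q < p)
  (x_frames : frames C f T g (power_step p) (power_smoothing beta0 q) x s).

Local Notation gamma := (power_step p).
Local Notation beta := (power_smoothing beta0 q).
Local Notation G k := (gap C f T g (beta k) (x k)).

Let gamma_in k : 0 < gamma k <= 1.
Proof.
have /andP[p0 _] := p_in; rewrite /power_step powR_gt0//= powRN invf_le1 ?powR_gt0//.
by rewrite powR_ge1// ltW.
Qed.

Let gammaV k : (gamma k)^-1 = k.+1%:R `^ p.
Proof. by rewrite /power_step powRN invrK. Qed.

Let betaV k : (beta k)^-1 = k.+1%:R `^ q / beta0.
Proof. by rewrite /power_smoothing invfM powRN invrK mulrC. Qed.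

Let beta_in k : 0 < beta k <= beta0.
Proof.
rewrite /power_smoothing mulr_gt0 ?powR_gt0//= ger_pMr// powRN invf_le1 ?powR_gt0//.
by rewrite powR_ge1// ltW.
Qed.

Let beta_antitone k : beta k.+1 <= beta k.
Proof.
rewrite /power_smoothing ler_pM2l// !powRN lef_pV2 ?posrE ?powR_gt0//.
by rewrite ge0_ler_powR ?nnegrE ?ler_nat// ltW.
Qed.

Let xC k : C (x k).
Proof.
elim: k => [|k IH]; first by case: x_frames.
have [[Cs _] ->] := x_frames.2 k.
by apply: convex_set_segment => //; have /andP[/ltW -> ->] := gamma_in k.
Qed.

Lemma frames_gap_ge0 k : 0 <= G k.
Proof. exact: (gap_ge0 (beta_in k) (xC k) (x_frames.2 k).1). Qed.

Let a k : R := k.+1%:R `^ p.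
Let P k y := moreau g (beta k) y.

Let a_incr k : 0 <= a k <= a k.+1.
Proof.
have /andP[p0 _] := p_in.
by rewrite powR_ge0/= ge0_ler_powR ?nnegrE ?ler_nat// ltW.
Qed.

Let sum_f N : \sum_(0 <= k < N.+1) a k * (f (x k) - f (x k.+1)) <=
  a N * (lip_f C f * ediam C).
Proof.
(* Anchoring the bound at the last iterate makes [V] minus the final value exactly the allowed
   oscillation. *)
pose V := f (x N.+1) + lip_f C f * ediam C.
have fV k : f (x k) <= V by rewrite -lerBlDl lip_f_oscillation.
have := @weighted_telescope _ a (fun k => f (x k)) (fun k => f (x k.+1))
  (fun=> V) N a_incr (fV 0%N).
rewrite [X in a N * X]addrC addKr; apply => k.
by rewrite subr_ge0 fV lexx.
Qed.

Let sum_g N : \sum_(0 <= k < N.+1) a k * (P k (T (x k)) - P k (T (x k.+1))) <=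
  a N * (B * (beta N)^-1).
Proof.
have TC k : (T @` C) (T (x k)) by exists (x k).
have beta0E : beta 0%N = beta0 by rewrite /power_smoothing powR1 mulr1.
(* [B / beta k] dominates both the oscillation of the first envelope on [T @` C]
   and the accumulated increments of the envelope as [beta] decreases. *)
pose c := P 0%N (T (x N.+1)).
pose V k := c + B * (beta k)^-1.
have incr k i : P k.+1 (T (x i)) <=
    P k (T (x i)) + B * ((beta k.+1)^-1 - (beta k)^-1).
  apply: moreau_increment_le => //; last by have /andP[] := beta_in k.
  by rewrite beta_antitone; have /andP[-> _] := beta_in k.+1.
have PV k i : P k (T (x i)) <= V k.
  elim: k => [|k IH].
    by rewrite /V -lerBlDl /c /P beta0E moreau_oscillation.
  by apply: le_trans (incr k i) _; move: IH; rewrite /V; lra.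
(* The last envelope value is at least [c], so the final gap [V N - P N (T (x N.+1))] is at most
   [B / beta N]. *)
have mono k : P 0%N (T (x N.+1)) <= P k (T (x N.+1)).
  rewrite /P beta0E; have /andP[bk bk0] := beta_in k.
  exact: (moreau_antitone D_neq0 D_closed Lg_ge0 h_lip _ bk bk0 rho_beta0 rho_ge0).
apply: (@le_trans _ _ (a N * (V N - P N (T (x N.+1))))); last first.
  have /andP[aN _] := a_incr N.
  by rewrite ler_wpM2l//; have := mono N; rewrite /V -/c; lra.
apply: weighted_telescope a_incr (PV 0%N 0%N) _ => k.
rewrite subr_ge0 PV/=.
by have := incr k k.+1; rewrite /V; lra.
Qed.

Lemma frames_gap_sum_le N : \sum_(0 <= k < N.+1) G k <=
  lip_f C f * ediam C * N.+1%:R `^ p + B / beta0 * N.+1%:R `^ (p + q) +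
  ediam C ^+ 2 / 2 * (L * (N.+1%:R `^ (1 - p) / (1 - p)) +
    opnorm T ^+ 2 / beta0 * (N.+1%:R `^ (1 - (p - q)) / (1 - (p - q)))).
Proof.
have /andP[p0 p1] := p_in.
have pq : 0 < p - q < 1.
  by rewrite subr_gt0 q_lt_p ltrBlDr ltr_wpDr// ltW.
apply: (@le_trans _ _ (\sum_(0 <= k < N.+1) (
   a k * (f (x k) - f (x k.+1)) + a k * (P k (T (x k)) - P k (T (x k.+1))) +
   ediam C ^+ 2 / 2 * (L * k.+1%:R `^ (- p) +
     opnorm T ^+ 2 / beta0 * k.+1%:R `^ (- (p - q)))))).
  apply: ler_sum_nat => k _.
  apply: le_trans (gap_le_decrease (beta_in k) (gamma_in k) (xC k)
    (x_frames.2 k).1) _.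
  rewrite -(x_frames.2 k).2 gammaV betaV -/(a k) /smoothed_obj -/(P k _) -/(P k _).
  (* The quotient [gamma k / beta k] is [k.+1 ^ (- (p - q)) / beta0], which gives the second power
     sum. *)
  rewrite opprB powRD ?pnatr_eq0 ?implybT// -/(gamma k).
  by lra.
rewrite !big_split/= -mulr_sumr big_split/= -!mulr_sumr.
apply: lerD; first apply: lerD.
- by rewrite mulrC; exact: sum_f.
- apply: le_trans (sum_g N) _; rewrite betaV powRD ?pnatr_eq0 ?implybT//.
  by rewrite /a; lra.
- rewrite ler_wpM2l ?divr_ge0 ?sqr_ge0//; apply: lerD.
  + by rewrite ler_pM2l// sum_powRN_le.
  + by rewrite ler_wpM2l ?divr_ge0 ?sqr_ge0 ?(ltW beta0_gt0)// sum_powRN_le.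
Qed.

End run.
End FrankWolfeStep.

Theorem theorem5p3 (R : realType) (n m : nat)
  (C : set 'rV[R]_n) (f : 'rV[R]_n -> R) (L : R)
  (T : {linear 'rV[R]_n -> 'rV[R]_m}) (g : 'rV[R]_m -> \bar R)
  (rho Bprox beta0 p q : R) (x s : nat -> 'rV[R]_n)
  (C_neq0 : C !=set0) (C_compact : compact C)
  (C_convex : @convex_set R 'rV[R]_n C)
  (f_C1 : C1_near C f) (L_gt0 : 0 < L)
  (f_smooth : elipschitz_on C L (gradient f))
  (g_case : penalty_caseI (T @` C) g rho Bprox \/
            penalty_caseII beta0 g rho Bprox)
  (p_in : 0 < p < 1) (q_in : 0 < q < 1) (q_lt_p : q < p) (pq_lt1 : p + q < 1)
  (beta0_gt0 : 0 < beta0) (beta0_lt : (beta0%:E < (rho%:E)^-1)%E)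
  (x_frames : frames C f T g (power_step p) (power_smoothing beta0 q) x s) :
  let G k := gap C f T g (power_smoothing beta0 q k) (x k) in
  let Cpq := constC C f T L rho Bprox beta0 p q in
  let rate (N : nat) := N%:R `^ (- Num.min (p - q) (1 - p - q)) in
  [/\ (forall N : nat, (1 <= N)%N -> 0 <= avg_upto G N <= Cpq * rate N),
      (forall N : nat, (1 <= N)%N -> 0 <= min_upto G N <= Cpq * rate N) &
      (p = 2^-1 -> q = 4^-1 ->
       let C' := constC_quarter C f T L rho Bprox beta0 in
       forall N : nat, (1 <= N)%N ->
         0 <= avg_upto G N <= C' * N%:R `^ (- 4^-1) /\
         0 <= min_upto G N <= C' * N%:R `^ (- 4^-1))].
Proof.
move=> G Cpq rate.
have /andP[p0 p1] := p_in; have /andP[q0 q1] := q_in.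
have f_diff z : C z -> differentiable f z.
  by have [U [_ CU Uf]] := f_C1 => /CU /Uf [].
have C_bounded := compact_ebounded C_neq0 C_compact.
have [D [h [Lg [[D0 Dcl Dcvx] [Lg0 hL rho0 wc] gE dist]]]] :=
  penalty_as_restricted (ebounded_image T C_bounded) g_case.
have rb := ltr_inver_mul rho0 beta0_lt.
subst g.
have G_ge0 k : 0 <= G k.
  exact: (frames_gap_ge0 C_convex f_diff D0 Dcl Dcvx Lg0 hL rho0 wc beta0_gt0
    rb p_in q0 x_frames).
have sumG N := frames_gap_sum_le C_neq0 C_compact C_convex f_diff L_gt0 f_smooth
  D0 Dcl Dcvx Lg0 hL rho0 wc beta0_gt0 rb dist p_in q0 q_lt_p x_frames N.
have B0 : 0 <= constB C T Bprox by exact: constB_ge0.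
have lip0 : 0 <= lip_f C f * ediam C.
  have [z Cz] := C_neq0.
  have := lip_f_oscillation C_neq0 C_compact C_convex f_diff L_gt0 f_smooth Cz Cz.
  by rewrite subrr.
have avg_le N : (1 <= N)%N -> avg_upto G N <= Cpq * rate N.
  case: N => // N _; rewrite /avg_upto.
  apply: (le_trans (ler_wpM2l _ (sumG N))); first by rewrite invr_ge0.
  have rate_ge0 : 0 <= rate N.+1 by exact: powR_ge0.
  have E (e : R) : e - 1 <= - Num.min (p - q) (1 - p - q) ->
    N.+1%:R^-1 * N.+1%:R `^ e <= rate N.+1 by exact: divN_powR_le.
  have min1 : Num.min (p - q) (1 - p - q) <= p - q by rewrite ge_min lexx.
  have min2 : Num.min (p - q) (1 - p - q) <= 1 - p - q by rewrite ge_min lexx orbT.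
  (* After division by [N], the exponents [p + q] and [1 - (p - q)] give exactly the two entries of
     the minimum; [p] and [1 - p] decay faster because [q > 0]. *)
  have E1 := E p ltac:(lra); have E2 := E (p + q) ltac:(lra).
  have E3 := E (1 - p) ltac:(lra); have E4 := E (1 - (p - q)) ltac:(lra).
  have s1 : 0 <= (1 - p)^-1 by rewrite invr_ge0; lra.
  have s2 : 0 <= (1 - (p - q))^-1 by rewrite invr_ge0; lra.
  have b0 : 0 <= beta0^-1 by rewrite invr_ge0 ltW.
  have K0 : 0 <= ediam C ^+ 2 / 2 by rewrite divr_ge0 ?sqr_ge0.
  (* The sharper sums are enlarged by the factors [2 ^ q] and [constM], both at least 1, to reach
     the stated constant. *)
  have q1' : 1 <= 2 `^ q :> R by rewrite powR_ge1// ltW.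
  have M1 : 1 <= constM rho beta0 by rewrite /constM le_max lexx.
  have t1 := ler_wpM2l lip0 E1.
  have t3 := ler_wpM2l (mulr_ge0 (mulr_ge0 K0 (ltW L_gt0)) s1) E3.
  have O0 := mulr_ge0 (mulr_ge0 K0 (mulr_ge0 (sqr_ge0 (opnorm T)) b0)) s2.
  have t4 := ler_wpM2l O0 E4.
  have t2 := ler_wpM2l (mulr_ge0 B0 b0) E2.
  have t2' := ler_wpM2r (mulr_ge0 (mulr_ge0 B0 b0) rate_ge0) q1'.
  have t4' := ler_wpM2r (mulr_ge0 O0 rate_ge0) M1.
  rewrite /Cpq /constC (_ : 1 - p + q = 1 - (p - q)); last first.
    by rewrite opprB addrA addrAC.
  move: t1 t2 t2' t3 t4 t4'.
  move: (N.+1%:R^-1) (N.+1%:R `^ p) (N.+1%:R `^ (p + q)) (N.+1%:R `^ (1 - p))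
    (N.+1%:R `^ (1 - (p - q))) (rate N.+1) (lip_f C f * ediam C) => i X1 X2 X3 X4 r A.
  move: (constB _ _ _) (beta0^-1) (2 `^ q) (ediam C ^+ 2) => B b Q E2'.
  move: (constM _ _) (opnorm T ^+ 2) ((1 - p)^-1) ((1 - (p - q))^-1) => M O y1 y2.
  clear; lra.
have min_le N : (1 <= N)%N -> min_upto G N <= Cpq * rate N.
  by move=> N1; apply: le_trans (min_upto_le_avg _ N1) (avg_le N N1).
split.
- by move=> N N1; rewrite avg_upto_ge0// avg_le.
- by move=> N N1; rewrite min_upto_ge0// min_le.
- move=> pE qE C' N N1.
  have rateE : rate N = N%:R `^ (- 4^-1).
    rewrite /rate pE qE; congr (_ `^ (- _)).
    rewrite (_ : 2^-1 - 4^-1 = 4^-1); last by field.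
    by rewrite (_ : 1 - 2^-1 - 4^-1 = 4^-1) ?minxx//; field.
  (* Here [1 - p = 1/2] and [1 - p + q = 3/4], so the half of the squared diameter is multiplied by
     2 and by 4/3. *)
  have CE : Cpq = C'.
    rewrite /Cpq /C' /constC /constC_quarter pE qE.
    by field; rewrite gt_eqF.
  rewrite -rateE -CE; split; first by rewrite avg_upto_ge0// avg_le.
  by rewrite min_upto_ge0// min_le.
Qed.
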